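(* Let $R$ be a P$v$MD. (1) If $R$ is a $t\#\#$-domain, then $R$ is a $tRTP$-domain. (2) If $R$ is a $tRTP$-domain and each $t$-prime of $R$ is branched, then $R$ is a $t\#\#$-domain.
   Context: $R$ is an integral domain with quotient field $K\neq R$. For nonzero $R$-submodules $A,B$ of $K$, $(A:B)=\{x\in K: xB\subseteq A\}$. For a nonzero fractional ideal $I$, $I_v=(R:(R:I))$, $I_t=\bigcup\{J_v: J\subseteq I\text{ nonzero finitely generated}\}$; $I$ is a $t$-ideal if $I=I_t$; a $t$-prime is a prime $t$-ideal; a $t$-maximal ideal is an ideal maximal among proper $t$-ideals. $R$ is a P$v$MD if $R_M$ is a valuation domain for every $t$-maximal $M$. A prime $P$ is branched if there is a $P$-primary ideal different from $P$. $R$ is a $t\#\#$-domain if $\bigcap_{P\in\mathcal P_1}R_P\neq\bigcap_{P\in\mathcal P_2}R_P$ for any two distinct sets $\mathcal P_1,\mathcal P_2$ of pairwise incomparable $t$-prime ideals of $R$. $R$ is a $tRTP$-domain if for each nonzero ideal $I$, either $(I(R:I))_t=R$ or $(I(R:I))_t$ is a radical ideal. *)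

(* Defs.v *)
From HB Require Import structures.
From mathcomp Require Import all_boot all_algebra fraction.
Set Implicit Arguments. Unset Strict Implicit. Unset Printing Implicit Defensive.
Import GRing.Theory.
Local Open Scope ring_scope.

Section Defs.
Variable R : idomainType.
Local Notation K := {fraction R}.
Local Notation "x %:F" := (@FracField.tofrac R x).

Definition inR (x : K) : Prop := exists r : R, x = r%:F.

Definition colonR (A : K -> Prop) : K -> Prop :=
  fun x => forall y, A y -> inR (x * y).

Definition vclos (A : K -> Prop) : K -> Prop := colonR (colonR A).

Definition span (s : seq K) : K -> Prop :=
  fun x => exists c : seq R, size c = size s /\
    x = \sum_(i < size s) (nth 0 c i)%:F * nth 0 s i.

Definition tclos (A : K -> Prop) : K -> Prop :=
  fun x => exists s : seq K, (forall y, y \in s -> A y) /\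
    (exists2 y, y \in s & y != 0) /\ vclos (span s) x.

Definition prodmod (A B : K -> Prop) : K -> Prop :=
  fun x => exists s : seq (K * K),
    (forall p, p \in s -> A p.1 /\ B p.2) /\
    x = \sum_(p <- s) (p.1 * p.2).

Definition ext (I : R -> Prop) : K -> Prop := fun x => exists2 r, I r & x = r%:F.

Definition ideal (I : R -> Prop) : Prop :=
  I 0 /\ (forall a b, I a -> I b -> I (a + b)) /\ (forall r a, I a -> I (r * a)).

Definition nonzero_ideal (I : R -> Prop) : Prop :=
  ideal I /\ exists2 a, I a & a != 0.

Definition proper (I : R -> Prop) : Prop := ~ I 1.

Definition prime_ideal (P : R -> Prop) : Prop :=
  ideal P /\ proper P /\ (forall a b, P (a * b) -> P a \/ P b).

Definition subsetR (I J : R -> Prop) : Prop := forall x, I x -> J x.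

(* t-ideal (of R, nonzero since the t-operation is defined on nonzero
   fractional ideals): I = I_t *)
Definition t_ideal (I : R -> Prop) : Prop :=
  nonzero_ideal I /\ (forall x, ext I x <-> tclos (ext I) x).

Definition t_prime (P : R -> Prop) : Prop := prime_ideal P /\ t_ideal P.

Definition t_maximal (M : R -> Prop) : Prop :=
  t_ideal M /\ proper M /\
  (forall J, t_ideal J -> proper J -> subsetR M J -> subsetR J M).

Definition loc (P : R -> Prop) : K -> Prop :=
  fun x => exists a s : R, ~ P s /\ x = a%:F / s%:F.

Definition valuation_subring (V : K -> Prop) : Prop :=
  forall x : K, x != 0 -> V x \/ V x^-1.

Definition PvMD : Prop :=
  forall M, t_maximal M -> valuation_subring (loc M).

Definition primary_for (Q P : R -> Prop) : Prop :=
  ideal Q /\ proper Q /\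
  (forall a b, Q (a * b) -> ~ Q a -> exists n, Q (b ^+ n)) /\
  (forall x, P x <-> exists n, Q (x ^+ n)).

Definition branched (P : R -> Prop) : Prop :=
  exists Q, primary_for Q P /\ ~ (forall x, Q x <-> P x).

Definition bigloc (F : (R -> Prop) -> Prop) : K -> Prop :=
  fun x => forall P, F P -> loc P x.

Definition incomparable_t_family (F : (R -> Prop) -> Prop) : Prop :=
  (forall P, F P -> t_prime P) /\
  (forall P Q, F P -> F Q -> subsetR P Q -> subsetR Q P).

Definition t_sharp_sharp : Prop :=
  forall F1 F2, incomparable_t_family F1 -> incomparable_t_family F2 ->
    F1 <> F2 -> ~ (forall x, bigloc F1 x <-> bigloc F2 x).

Definition tRTP : Prop :=
  forall I, nonzero_ideal I ->
    let J := tclos (prodmod (ext I) (colonR (ext I))) in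
    (forall x, J x <-> inR x) \/
    (forall (r : R) (n : nat), J ((r ^+ n)%:F) -> J r%:F).

End Defs.

(* Main.v *)
(* In a PvMD each t-prime P gives a valuation ring R_P, I_t is contained in
   I R_P, and a t-closed module is the intersection of its localizations at the
   t-maximal ideals.

   (1) If J = I (R : I) and J_t is not radical, there are a t-maximal M at which
   J R_M is not radical and a t-prime P contained in M with P R_M the radical
   of J R_M. Applying t## to the t-maximal ideals not containing P, with and
   without P adjoined, yields u outside R_P which lies in R_N for each t-maximal
   N not containing P. Powers of u show that (P R_P : I) is contained in
   (R : I) R_M, whence P is contained in J R_M, a contradiction.

   (2) Let Q be P-primary, Q <> P. If (R : Q) were contained in R_P, then
   Q (R : Q) = Q would be a non-radical trace. So some u in (R : Q) is outside
   R_P, while u lies in R_N for each prime N not containing P. Such elements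
   tell apart two distinct incomparable families. *)
From HB Require Import structures.
From mathcomp Require Import all_boot all_algebra fraction.
From mathcomp Require Import boolp classical_sets.
Require Import Defs.

Set Implicit Arguments. Unset Strict Implicit. Unset Printing Implicit Defensive.
Import GRing.Theory.
Local Open Scope ring_scope.

Section TIdeals.
Variable R : idomainType.
Local Notation K := {fraction R}.
Local Notation "x %:F" := (@FracField.tofrac R x).

(** * Submodules of [K], colons and the t-closure *)

Lemma frac_denom (x : K) : exists2 d : R, d != 0 & inR (d%:F * x).
Proof.
elim/quotW: x => r; exists (\d_r); first exact: denom_ratioP.
exists (\n_r); apply/eqP; change (FracField.mul (\d_r)%:F (\pi r)%qT == (\n_r)%:F).
rewrite !piE /FracField.equivf /FracField.mulf.
by rewrite !numden_Ratio ?oner_eq0 ?mul1r ?denom_ratioP // mulr1 mulrC.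
Qed.

Definition submod (A : K -> Prop) : Prop :=
  [/\ A 0, (forall x y, A x -> A y -> A (x + y)) &
      (forall r x, A x -> A (r%:F * x))].

Lemma inR_frac r : inR r%:F.
Proof. by exists r. Qed.

Lemma inR0 : inR (0 : K).
Proof. by exists 0; rewrite tofrac0. Qed.

Lemma inR1 : inR (1 : K).
Proof. by exists 1; rewrite tofrac1. Qed.

Lemma inRM (x y : K) : inR x -> inR y -> inR (x * y).
Proof. by move=> [a ->] [b ->]; exists (a * b); rewrite tofracM. Qed.

Lemma submod_inR : submod (@inR R).
Proof.
split; first exact: inR0.
  by move=> _ _ [a ->] [b ->]; exists (a + b); rewrite tofracD.
by move=> r x Rx; apply: inRM => //; exists r.
Qed.

Lemma submod_ext (I : R -> Prop) : ideal I -> submod (ext I).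
Proof.
move=> [I0 [ID IM]]; split; first by exists 0; rewrite ?tofrac0.
  by move=> _ _ [a Ia ->] [b Ib ->]; exists (a + b); rewrite ?tofracD //; exact: ID.
by move=> r _ [a Ia ->]; exists (r * a); rewrite ?tofracM //; exact: IM.
Qed.

Lemma ext_tofrac (I : R -> Prop) r : ext I r%:F <-> I r.
Proof.
split=> [[a Ia /eqP]|Ir]; last by exists r.
by rewrite tofrac_eq => /eqP ->.
Qed.

Lemma submod_colonR (A : K -> Prop) : submod (colonR A).
Proof.
have [R0 RD RM] := submod_inR.
split=> [y _|x y Ax Ay z Az|r x Ax z Az]; first by rewrite mul0r.
  by rewrite mulrDl; apply: RD; [exact: Ax|exact: Ay].
by rewrite -mulrA; apply: RM; exact: Ax.
Qed.

Lemma submod_prodmod (A B : K -> Prop) : submod A -> submod (prodmod A B).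
Proof.
move=> [A0 AD AM]; split; first by exists [::]; rewrite big_nil.
  move=> _ _ [s [sAB ->]] [s' [sAB' ->]]; exists (s ++ s'); rewrite big_cat; split=> // p.
  by rewrite mem_cat => /orP[/sAB|/sAB'].
move=> r _ [s [sAB ->]]; exists [seq (r%:F * p.1, p.2) | p <- s]; split.
  by move=> _ /mapP[p /sAB[Ap Bp] ->]; split=> //=; exact: AM.
by rewrite big_map mulr_sumr; apply: eq_bigr => p _; rewrite /= mulrA.
Qed.

Lemma submod_sum (A : K -> Prop) (T : eqType) (s : seq T) (F : T -> K) :
  submod A -> (forall p, p \in s -> A (F p)) -> A (\sum_(p <- s) F p).
Proof.
move=> [A0 AD _]; elim: s => [|p s IHs] AF; first by rewrite big_nil.
rewrite big_cons; apply: AD; first by apply: AF; rewrite mem_head.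
by apply: IHs => q qs; apply: AF; rewrite inE qs orbT.
Qed.

Lemma prodmodM (A B : K -> Prop) x y : A x -> B y -> prodmod A B (x * y).
Proof.
move=> Ax By; exists [:: (x, y)]; rewrite big_seq1; split=> // p.
by rewrite inE => /eqP ->.
Qed.

Lemma prodmod_sub (A B T : K -> Prop) : submod T ->
  (forall x y, A x -> B y -> T (x * y)) -> forall z, prodmod A B z -> T z.
Proof.
move=> Tsub TAB _ [s [sAB ->]]; apply: submod_sum => // p /sAB[Ap Bp].
exact: TAB.
Qed.

Lemma span_mem (s : seq K) z : z \in s -> span s z.
Proof.
move=> zs; have lt_z : (index z s < size s)%N by rewrite index_mem.
exists (mkseq (fun i => (i == index z s)%:R) (size s)); rewrite size_mkseq; split=> //.
rewrite (bigD1 (Ordinal lt_z)) //= big1 => [|i ne_i].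
  by rewrite nth_mkseq // eqxx tofrac1 mul1r nth_index // addr0.
by rewrite nth_mkseq // (negPf (_ : val i != _)) // tofrac0 mul0r.
Qed.

Lemma colonR_span (s : seq K) y :
  colonR (span s) y <-> forall z, z \in s -> inR (y * z).
Proof.
split=> [sy z /span_mem zs|sy _ [c [_ ->]]]; first exact: sy.
rewrite mulr_sumr; apply: submod_sum => [|i _]; first exact: submod_inR.
by rewrite mulrCA; apply: inRM; [exists (nth 0 c i)|apply/sy/mem_nth].
Qed.

(** The working form of the v-closure: multipliers are tested on generators, so linear combinations
    no longer appear. *)
Lemma vclos_span (s : seq K) x : vclos (span s) x <->
  forall y, (forall z, z \in s -> inR (y * z)) -> inR (x * y).
Proof. by split=> sx y /colonR_span; exact: sx. Qed.

Lemma sub_tclos (A : K -> Prop) x : (exists2 a, A a & a != 0) -> A x -> tclos A x.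
Proof.
(* The entry [a] supplies the nonzero generator when [x] is zero. *)
move=> [a Aa a0] Ax; exists [:: x; a]; split.
  by move=> y; rewrite !inE => /orP[]/eqP ->.
split; first by exists a; rewrite // !inE eqxx orbT.
by apply/vclos_span => y; rewrite mulrC; apply; rewrite mem_head.
Qed.

Lemma submod_tclos (A : K -> Prop) : (exists2 a, A a & a != 0) -> submod A ->
  submod (tclos A).
Proof.
move=> nzA [A0 AD AM]; have [R0 RD RM] := submod_inR; split.
- exact: sub_tclos.
- move=> x y [s [sA [[a sa a0] /vclos_span sx]]] [s' [sA' [_ /vclos_span sy]]].
  exists (s ++ s'); split; first by move=> z; rewrite mem_cat => /orP[/sA|/sA'].
  split; first by exists a; rewrite // mem_cat sa.
  apply/vclos_span => w sw; rewrite mulrDl.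
  by apply: RD; [apply: sx|apply: sy] => z sz; apply: sw; rewrite mem_cat sz ?orbT.
- move=> r x [s [sA [nzs /vclos_span sx]]]; exists s; do 2?split=> //.
  by apply/vclos_span => w /sx Rw; rewrite -mulrA; exact: RM.
Qed.

Lemma tclos_mono (A B : K -> Prop) : (forall x, A x -> B x) ->
  forall x, tclos A x -> tclos B x.
Proof. by move=> AB x [s [sA sx]]; exists s; split=> // y /sA /AB. Qed.

(** Each of the finitely many generators in [s] lies in the v-closure of a finite part of [A].
    Concatenating these parts gives [s']: whatever multiplies [s'] into [R] also multiplies [s] into
    [R]. The element [b] keeps a nonzero generator in the list. *)
Lemma tclos_idem (A : K -> Prop) x : tclos (tclos A) x -> tclos A x.
Proof.
move=> [s [sA [[a sa a0] /vclos_span sx]]].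
have [b [Ab b0]] : exists b, A b /\ b != 0.
  by have [s' [sA' [[b sb b0] _]]] := sA _ sa; exists b; split=> //; exact: sA'.
suff [s' s'A s's] : exists2 s' : seq K, (forall z, z \in s' -> A z) &
    forall y, (forall z, z \in s' -> inR (y * z)) -> forall z, z \in s -> inR (y * z).
  exists (b :: s'); split; first by move=> z; rewrite inE => /predU1P[->|/s'A].
  split; first by exists b; rewrite ?mem_head.
  apply/vclos_span => y sy; apply/sx/s's => z sz.
  by apply: sy; rewrite inE sz orbT.
elim: s sA {sa sx} => [|c s IHs] sA; first by exists [::].
have [z sz|s1 s1A s1s] := IHs; first by apply: sA; rewrite inE sz orbT.
have [s2 [s2A [_ /vclos_span s2c]]] := sA c (mem_head _ _).
exists (s1 ++ s2) => [z|y sy z]; first by rewrite mem_cat => /orP[/s1A|/s2A].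
rewrite inE => /predU1P[->|sz].
  by rewrite mulrC; apply: s2c => w sw; apply: sy; rewrite mem_cat sw orbT.
by apply: s1s sz => w sw; apply: sy; rewrite mem_cat sw.
Qed.

Lemma tclos_inR (A : K -> Prop) : (forall x, A x -> inR x) ->
  forall x, tclos A x -> inR x.
Proof.
move=> AR x [s [sA [_ /vclos_span sx]]]; rewrite -[x]mulr1; apply: sx => z /sA.
by rewrite mul1r; exact: AR.
Qed.

Lemma tclos_scale (T : K -> Prop) c x : c != 0 ->
  tclos (fun y => T (y * c)) x -> tclos T (x * c).
Proof.
move=> c0 [s [sT [[a sa a0] /vclos_span sx]]].
exists [seq y * c | y <- s]; split; first by move=> _ /mapP[y /sT ? ->].
split; first by exists (a * c); rewrite ?mulf_neq0 //; exact: map_f.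
apply/vclos_span => y sy; rewrite -mulrA [c * y]mulrC; apply: sx => z sz.
by rewrite -mulrA [c * z]mulrC; apply/sy/map_f.
Qed.

(** * Conductors, t-maximal ideals and the local-global principle *)

(** This ideal is the conductor of [c] into [T]. Its t-closure stays in [R], and multiplication by
    [c] carries it into the t-closure of [T]. *)
Lemma t_ideal_colon (T : K -> Prop) c : submod T ->
  (forall x, tclos T x -> T x) -> (exists2 r, r != 0 & T (r%:F * c)) ->
  t_ideal (fun r => T (r%:F * c)).
Proof.
move=> [T0 TD TM] Tcl [r0 r0n0 Tr0].
have nz : exists2 a, ext (fun r => T (r%:F * c)) a & a != 0.
  by exists r0%:F; [exists r0|rewrite tofrac_eq0].
split.
  split; last by exists r0.
  split; first by rewrite tofrac0 mul0r.
  split=> [a b Ta Tb|r a Ta]; first by rewrite tofracD mulrDl; exact: TD.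
  by rewrite tofracM -mulrA; exact: TM.
move=> x; split=> [|xcl]; first exact: sub_tclos.
have [r Er] : inR x.
  by apply: tclos_inR xcl => y [b _ ->]; exists b.
exists r => //; rewrite -Er; have [->|c0] := eqVneq c 0; first by rewrite mulr0.
by apply/Tcl/tclos_scale => //; apply: tclos_mono xcl => y [b Tb ->].
Qed.

Lemma t_ideal_tclos (I : R -> Prop) : t_ideal I -> forall x, tclos (ext I) x -> ext I x.
Proof. by move=> [_ It] x /It. Qed.

(** Zorn's lemma applies because the t-closure is finitary: only finitely many elements of a union
    of a chain are involved at a time, and they lie in one member. *)
Lemma exists_t_maximal (I : R -> Prop) : t_ideal I -> proper I ->
  exists2 M, t_maximal M & subsetR I M.
Proof.
move=> tI prI.
(* Adjoining [I] makes the empty chain harmless: its union is then replaced by [I]. *)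
pose P (X : set R) := t_ideal (X `|` I)%classic /\ proper (X `|` I)%classic.
have [|A [[tA prA] maxA]] := @Zorn_bigcup R P; last first.
  exists (A `|` I)%classic => [|x Ix]; last by right.
  split=> //; split=> // J tJ prJ AIJ.
  have EJ : (J `|` I)%classic = J by apply/setUidPl => x Ix; apply: AIJ; right.
  apply: contrapT => nJA; apply: (maxA J); last by rewrite /P EJ.
  by split=> [x Ax|JA]; [apply: AIJ; left|apply: nJA => x /JA Ax; left].
move=> F FP Ftot; set U := (\bigcup_(X in F) X `|` I)%classic.
have finU (s : seq K) : (forall y, y \in s -> @ext R U y) ->
    exists X, [/\ P X, (X `<=` U)%classic & forall y, y \in s -> @ext R (X `|` I)%classic y].
  suff finF : (forall y, y \in s -> @ext R U y) -> exists X, (X = set0 \/ F X) /\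
      forall y, y \in s -> @ext R (X `|` I)%classic y.
    move=> /finF[X [XF sX]]; exists X; split=> //.
      by case: XF => [->|/FP//]; rewrite /P set0U.
    by case: XF => [->|FX] x //= Xx; left; exists X.
  elim: s => [|y s IHs] sU; first by exists set0; split=> //; left.
  have [z sz|X [XF sX]] := IHs; first by apply: sU; rewrite inE sz orbT.
  have [r Ur ry] := sU y (mem_head _ _).
  have [Y [YF Yr]] : exists Y, (Y = set0 \/ F Y) /\ (Y `|` I)%classic r.
    case: Ur => [[Y FY Yr]|Ir]; first by exists Y; split; [right|left].
    by exists set0; split; [left|right].
  have [XY|YX] : (X `<=` Y)%classic \/ (Y `<=` X)%classic.
    case: XF YF => [->|FX] [->|FY]; do ?[by left|by right].
    exact: Ftot.
  - exists Y; split=> // z; rewrite inE => /predU1P[->|/sX]; first by exists r.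
    by move=> [x [/XY Yx|Ix] ->]; exists x => //; [left|right].
  - exists X; split=> // z; rewrite inE => /predU1P[->|/sX//].
    by case: Yr => [/YX Xr|Ir]; exists r => //; [left|right].
have UI X x : (X `<=` U)%classic -> (X `|` I)%classic x -> U x.
  by move=> XU [/XU|]//; right.
have [[[I0 _] nzI] _] := tI.
split; last first.
  move=> U1; have [y|X [[_ prX] XU sX]] := finU [:: 1%:F].
    by rewrite inE => /eqP ->; apply/ext_tofrac.
  by apply: prX; apply/ext_tofrac/sX; rewrite mem_head.
have nzU : exists2 a, U a & a != 0 by have [a Ia a0] := nzI; exists a => //; right.
split.
  split=> //; split; first by right.
  split=> [a b Ua Ub|r a Ua].
    have [y|X [[[[[_ [XD _]] _] _] _] XU sX]] := finU [:: a%:F; b%:F].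
      by rewrite !inE => /orP[]/eqP ->; apply/ext_tofrac.
    by apply: UI (XD a b _ _) => //; apply/ext_tofrac/sX; rewrite !inE eqxx ?orbT.
  have [y|X [[[[[_ [_ XM]] _] _] _] XU sX]] := finU [:: a%:F].
    by rewrite inE => /eqP ->; apply/ext_tofrac.
  by apply: UI (XM r a _) => //; apply/ext_tofrac/sX; rewrite inE.
move=> x; split=> [|[s [/finU[X [[[_ tX] _] XU sX]] sx]]].
  by apply: sub_tclos; have [a Ua a0] := nzU; exists a%:F; [exists a|rewrite tofrac_eq0].
have [|r Xr ->] := (tX x).2; first by exists s.
by exists r => //; apply: UI Xr.
Qed.

(** If [a * b] is in [M] and [a] is not, the conductor [J] of [a] into [M] is a proper t-ideal
    containing [M] and [b], so maximality puts [b] in [M]. *)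
Lemma t_maximal_prime (M : R -> Prop) : t_maximal M -> prime_ideal M.
Proof.
move=> [tM [prM maxM]]; have [[idM nzM] _] := tM; have [_ [_ MM]] := idM.
split=> //; split=> // a b Mab.
have [Ma|nMa] := pselect (M a); first by left.
right; pose J r := ext M (r%:F * a%:F).
have EJ r : J r <-> M (r * a) by rewrite /J -tofracM; exact: ext_tofrac.
have MJ : subsetR M J by move=> r Mr; apply/EJ; rewrite mulrC; exact: MM.
apply: (maxM J) => //; last by apply/EJ; rewrite mulrC.
  apply: t_ideal_colon; [exact: submod_ext|exact: t_ideal_tclos|].
  by have [r Mr r0] := nzM; exists r => //; exact: MJ.
by move=> /EJ; rewrite mul1r.
Qed.

(* The localization [A R_P] of an [R]-submodule [A] of [K]. *)
Definition locmod (P : R -> Prop) (A : K -> Prop) (x : K) : Prop :=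
  exists2 s, ~ P s & A (s%:F * x).

(** If [x] is not in [T], its conductor into [T] is a proper t-ideal, hence lies in some t-maximal
    [N]; the local hypothesis at [N] gives an element of the conductor outside [N]. *)
Lemma t_local_global (T : K -> Prop) x : submod T ->
  (forall y, tclos T y -> T y) -> (exists2 r, r != 0 & T (r%:F * x)) ->
  (forall N, t_maximal N -> locmod N T x) -> T x.
Proof.
move=> Tsub Tcl nzx locx; apply: contrapT => nTx.
have [||N tN subN] := @exists_t_maximal (fun r => T (r%:F * x)).
- exact: t_ideal_colon.
- by move=> T1; apply: nTx; rewrite -[x]mul1r -tofrac1.
by have [s nNs Tsx] := locx N tN; apply/nNs/subN.
Qed.

(** * Localization at a prime, and the case of a valuation ring *)

Section Localization.
Variables (P : R -> Prop) (Pp : prime_ideal P).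

Lemma primeNM a b : ~ P a -> ~ P b -> ~ P (a * b).
Proof. by have [_ [_ PM]] := Pp => nPa nPb /PM[]. Qed.

Lemma primeX a n : P (a ^+ n) -> P a.
Proof.
have [_ [Ppr PM]] := Pp; elim: n => [|n IHn]; first by rewrite expr0 => /Ppr.
by rewrite exprS => /PM[].
Qed.

Lemma primeN_neq0 s : ~ P s -> s%:F != 0.
Proof.
have [[P0 _] _] := Pp; rewrite tofrac_eq0 => nPs.
by apply/eqP => s0; apply: nPs; rewrite s0.
Qed.

Lemma locE x : loc P x <-> locmod P (@inR R) x.
Proof.
split=> [[a [s [nPs ->]]]|[s nPs [a Ea]]].
  by exists s => //; exists a; rewrite mulrC divfK // primeN_neq0.
exists a, s; split=> //; rewrite -Ea mulrC mulKf //; exact: primeN_neq0.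
Qed.

Lemma locmod_sub (A : K -> Prop) x : submod A -> A x -> locmod P A x.
Proof.
have [_ [Ppr _]] := Pp => [[_ _ AM] Ax].
by exists 1 => //; exact: AM.
Qed.

Lemma locmodM (A : K -> Prop) v x : submod A -> loc P v -> locmod P A x ->
  locmod P A (v * x).
Proof.
move=> [_ _ AM] /locE[s nPs [a Ea]] [t nPt Atx].
exists (s * t); first exact: primeNM.
by rewrite tofracM mulrACA Ea; exact: AM.
Qed.

Lemma submod_locmod (A : K -> Prop) : submod A -> submod (locmod P A).
Proof.
move=> As; have [A0 AD AM] := As; split.
- exact: locmod_sub.
- move=> x y [s nPs Asx] [t nPt Aty]; exists (s * t); first exact: primeNM.
  rewrite mulrDr tofracM; apply: AD; last by rewrite -mulrA; exact: AM.
  by rewrite [s%:F * _]mulrC -mulrA; exact: AM.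
- move=> r x [s nPs Asx]; exists s => //.
  by rewrite mulrCA; exact: AM.
Qed.

Lemma loc_inR x : inR x -> loc P x.
Proof. by move=> Rx; apply/locE/locmod_sub => //; exact: submod_inR. Qed.

Lemma locM x y : loc P x -> loc P y -> loc P (x * y).
Proof. by move=> Px /locE Py; apply/locE/locmodM => //; exact: submod_inR. Qed.

Lemma locX x n : loc P x -> loc P (x ^+ n).
Proof.
move=> Px; elim: n => [|n IHn]; first exact/loc_inR/inR1.
by rewrite exprS; exact: locM.
Qed.

Lemma locD x y : loc P x -> loc P y -> loc P (x + y).
Proof.
have [_ PD _] := submod_locmod submod_inR.
by move=> /locE Px /locE Py; apply/locE/PD.
Qed.

Lemma locmod_ext_loc (I : R -> Prop) x : locmod P (ext I) x -> loc P x.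
Proof. by move=> [s nPs [a _ Ea]]; apply/locE; exists s => //; exists a. Qed.

(** Here [locmod P (ext P)] is the maximal ideal [P R_P], the set of nonunits of [R_P]. *)
Lemma loc_unit x : loc P x -> locmod P (ext P) x \/ loc P x^-1.
Proof.
move=> /locE[s nPs [a Ea]]; have [Pa|nPa] := pselect (P a).
  by left; exists s => //; exists a.
right; apply/locE; exists a => //; exists s; rewrite -Ea mulfK //.
apply/eqP => x0; have := primeN_neq0 nPa.
by rewrite -Ea x0 mulr0 eqxx.
Qed.

Hypothesis Pval : valuation_subring (loc P).

Lemma locN_inv u : ~ loc P u -> locmod P (ext P) u^-1.
Proof.
move=> nu; have u0 : u != 0 by apply/eqP => u0; apply: nu; rewrite u0; exact/loc_inR/inR0.
by have [//|/loc_unit[//|]] := Pval u0; rewrite invrK.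
Qed.

Lemma locmodN_inv x : ~ locmod P (ext P) x -> loc P x^-1.
Proof.
move=> nx; have [x0|x0] := eqVneq x 0; first by rewrite x0 invr0; exact/loc_inR/inR0.
by have [/loc_unit[]|] := Pval x0.
Qed.

(** Divisibility is total in a valuation ring, so [f] can be taken as an entry of least value. *)
Lemma seq_loc_gen (s : seq K) : (exists2 y, y \in s & y != 0) ->
  exists f, [/\ f \in s, f != 0 & forall z, z \in s -> loc P (z / f)].
Proof.
have P1 : loc P 1 by exact/loc_inR/inR1.
elim: s => [[]//|a s IHs] nz.
have [/hasP[b sb b0]|/hasPn s0] := boolP (has (fun y => y != 0) s).
  have [|f [sf f0 fs]] := IHs; first by exists b.
  have [a0|a0] := eqVneq a 0.
    exists f; split=> // [|z]; first by rewrite inE sf orbT.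
    rewrite inE => /predU1P[->|/fs//]; rewrite a0 mul0r; exact/loc_inR/inR0.
  have [af|fa] := Pval (mulf_neq0 a0 (invr_neq0 f0)).
    exists f; split=> // [|z]; first by rewrite inE sf orbT.
    by rewrite inE => /predU1P[->|/fs//].
  exists a; split=> // [|z]; first exact: mem_head.
  rewrite inE => /predU1P[->|/fs zf]; first by rewrite divff.
  have -> : z / a = z / f * (a / f)^-1 by rewrite invf_div mulrA divfK.
  exact: locM.
have {}s0 z : z \in s -> z = 0 by move=> /s0; rewrite negbK => /eqP.
have a0 : a != 0.
  by have [y] := nz; rewrite inE => /predU1P[->//|/s0 ->]; rewrite eqxx.
exists a; split=> // [|z]; first exact: mem_head.
by rewrite inE => /predU1P[->|/s0 ->]; rewrite ?divff // mul0r; exact/loc_inR/inR0.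
Qed.

Lemma common_denom (s : seq K) : (forall z, z \in s -> loc P z) ->
  exists2 t, ~ P t & forall z, z \in s -> inR (t%:F * z).
Proof.
have [_ [Ppr _]] := Pp; elim: s => [|a s IHs] sP; first by exists 1.
have [z sz|t nPt ts] := IHs; first by apply: sP; rewrite inE sz orbT.
have /locE[t' nPt' t'a] := sP a (mem_head _ _).
exists (t * t'); first exact: primeNM.
move=> z; rewrite inE => /predU1P[->|/ts tz]; rewrite tofracM.
  by rewrite -mulrA; apply: inRM => //; exact: inR_frac.
by rewrite mulrAC; apply: inRM => //; exact: inR_frac.
Qed.

(* A finitely generated ideal becomes principal in the valuation ring, hence
   its v-closure has the same localization. *)
Lemma tclos_locmod (A : K -> Prop) x : submod A -> tclos A x -> locmod P A x.
Proof.
move=> As [s [sA [nzs /vclos_span sx]]].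
have [f [sf f0 fs]] := seq_loc_gen nzs.
have [|t nPt ts] := @common_denom [seq z / f | z <- s].
  by move=> _ /mapP[z /fs zf ->].
exists t => //; have [a Ea] : inR (x * (t%:F / f)).
  apply: sx => z sz; rewrite mulrAC -mulrA; exact/ts/map_f.
have -> : t%:F * x = a%:F * f by rewrite -Ea mulrA divfK // mulrC.
by have [_ _ AM] := As; exact/AM/sA.
Qed.

End Localization.

Lemma loc_subset (P M : R -> Prop) x : subsetR P M -> loc M x -> loc P x.
Proof. by move=> PM [a [s [nMs ->]]]; exists a, s; split=> // /PM. Qed.

(** With [s x = a], either [x = c / d] over [N], and [c s = d a] forces [c] into [P]; or
    [x^-1 = c / d], and [d s = c a] lies in [P] although [d] and [s] do not. Hence
    [P R_P = P R_N]. *)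
Lemma locmod_ext_prime (P N : R -> Prop) x : prime_ideal P -> prime_ideal N ->
  subsetR P N -> valuation_subring (loc N) ->
  locmod P (ext P) x -> locmod N (ext P) x.
Proof.
move=> Pp Np PN Nval; have [Pid [_ PM]] := Pp => [[s nPs [a Pa Ea]]].
have [x0|x0] := eqVneq x 0.
  by rewrite x0; have [N0 _ _] := submod_locmod Np (submod_ext Pid).
have [/(locE Np)[d nNd [c Ec]]|/(locE Np)[d nNd [c Ec]]] := Nval x x0.
  exists d => //; exists c => //.
  have : P (c * s).
    suff -> : c * s = d * a by have [_ [_ IM]] := Pid; exact: IM.
    by apply/eqP; rewrite -tofrac_eq !tofracM -Ea -Ec -mulrA [x * _]mulrC.
  by move=> /PM[].
suff /PM[] : P (d * s) by [move=> /PN|].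
suff -> : d * s = c * a by have [_ [_ IM]] := Pid; exact: IM.
apply/eqP; rewrite -tofrac_eq !tofracM -Ea -Ec.
by rewrite [s%:F * x]mulrC mulrA mulfVK.
Qed.

(** * The t-primes of a P[v]MD and radicals in its valuation rings *)

Section PvMD.
Hypothesis hP : PvMD R.

Lemma t_prime_val (P : R -> Prop) : t_prime P -> valuation_subring (loc P).
Proof.
move=> [[_ [Ppr _]] tP] x x0; have [M tM PM] := exists_t_maximal tP Ppr.
by have [Mx|Mx] := hP tM x0; [left|right]; apply: loc_subset Mx.
Qed.

(** The t-closure of [P] lies in [P R_M], whose intersection with [R] is [P]. *)
Lemma sub_t_maximal_t_prime (P M : R -> Prop) : prime_ideal P -> (exists2 a, P a & a != 0) ->
  t_maximal M -> subsetR P M -> t_prime P.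
Proof.
move=> Pp nzP tM PM; have [Pid [_ PpM]] := Pp; split=> //; split=> // x; split.
  apply: sub_tclos; have [a Pa a0] := nzP.
  by exists a%:F; [exists a|rewrite tofrac_eq0].
move=> xcl; have [r Er] : inR x by apply: tclos_inR xcl => y [b _ ->]; exists b.
have := tclos_locmod (t_maximal_prime tM) (hP tM) (submod_ext Pid) xcl.
rewrite Er => -[s nMs]; rewrite -tofracM => /ext_tofrac /PpM[/PM//|Pr].
exact/ext_tofrac.
Qed.

Lemma t_sharp_sharp_witness (P : R -> Prop) : t_sharp_sharp R -> t_prime P ->
  exists2 u, ~ loc P u & forall N, t_maximal N -> ~ subsetR P N -> loc N u.
Proof.
move=> ts tP; pose F1 N := t_maximal N /\ ~ subsetR P N.
apply: contrapT => nu; apply: (ts F1 (fun N => F1 N \/ N = P)).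
- split=> [N [tN _]|N N' [[_ [_ maxN]] _] [[tN' [prN' _]] _]].
    by split; [exact: t_maximal_prime|case: tN].
  exact: maxN.
- split=> [N [[tN _]|->//]|N N'].
    by split; [exact: t_maximal_prime|case: tN].
  move=> [[[_ [_ maxN]] nPN]|->] [[[tN' [prN' _]] nPN']|->] //.
  + exact: maxN.
  (* If [N] were contained in [P], maximality of [N] would give [P] inside [N]. *)
  + by have [[_ [prP _]] tiP] := tP => NP; have /nPN := maxN P tiP prP NP.
- move=> E; suff [_] : F1 P by apply.
  by rewrite E /=; right.
- move=> x; split=> Fx N; last by move=> FN; apply: Fx; left.
  move=> [/Fx//|->]; apply: contrapT => nPx; apply: nu; exists x => // N' tN' nPN'.
  exact: Fx.
Qed.

(** Of two elements one divides the other in [R_M]. If [x = v y], then [x + y = (v + 1) y] handles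
    sums, and [x^2 = v (x y)] shows that [x] is in the radical as soon as [x y] is. *)
Lemma locmod_radical_prime (M : R -> Prop) (J : K -> Prop) : prime_ideal M ->
  valuation_subring (loc M) -> submod J -> ~ locmod M J 1 ->
  prime_ideal (fun x => exists n, locmod M J (x ^+ n)%:F).
Proof.
move=> Mp Mval Js nJ1; set P := fun x => _.
have [Q0 _ _] := submod_locmod Mp Js.
have Pdvd x y v : loc M v -> x%:F = v * y%:F -> P y -> P x.
  move=> Mv Exy [n Jyn]; exists n; rewrite tofracXn Exy exprMn -tofracXn.
  by apply: locmodM => //; exact: locX.
have Pcmp x y : (exists2 v, loc M v & x%:F = v * y%:F) \/
                (exists2 v, loc M v & y%:F = v * x%:F).
  have [->|y0] := eqVneq y 0.
    by right; exists 0; rewrite ?tofrac0 ?mul0r //; exact/loc_inR/inR0.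
  have [->|x0] := eqVneq x 0.
    by left; exists 0; rewrite ?tofrac0 ?mul0r //; exact/loc_inR/inR0.
  rewrite -tofrac_eq0 in y0; rewrite -tofrac_eq0 in x0.
  have [Mv|Mv] := Mval _ (mulf_neq0 x0 (invr_neq0 y0)).
    by left; exists (x%:F / y%:F); [|rewrite divfK].
  by right; exists (y%:F / x%:F); [rewrite -invf_div|rewrite divfK].
have Psq x : P (x * x) -> P x.
  by move=> [n]; rewrite -expr2 -exprM => Jn; exists (2 * n)%N.
have M1 : loc M 1 by exact/loc_inR/inR1.
split; [split; [|split]|split].
- by exists 1; rewrite expr1 tofrac0.
- move=> x y Px Py; have [[v Mv E]|[v Mv E]] := Pcmp x y.
    by apply: (Pdvd _ y (v + 1)); [exact: locD|rewrite tofracD mulrDl mul1r E|].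
  by apply: (Pdvd _ x (1 + v)); [exact: locD|rewrite tofracD mulrDl mul1r E|].
- move=> r x; apply: (Pdvd _ x r%:F); last by rewrite tofracM.
  exact/loc_inR/inR_frac.
- by move=> [n]; rewrite expr1n tofrac1.
- move=> x y Pxy; have [[v Mv E]|[v Mv E]] := Pcmp x y; [left|right]; apply: Psq.
    by apply: Pdvd Mv _ Pxy; rewrite !tofracM {1}E -mulrA [y%:F * _]mulrC.
  by apply: Pdvd Mv _ Pxy; rewrite !tofracM {1}E mulrA.
Qed.

(** * The trace [I (R : I)] at a t-maximal ideal *)

Section Trace.
Variables (I M P : R -> Prop) (u : K).
Local Notation A := (ext I).
Local Notation G := (colonR A).
Local Notation J := (prodmod A G).
Hypotheses (idI : ideal I) (tM : t_maximal M) (Pp : prime_ideal P) (PM : subsetR P M).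
Hypothesis radP : forall x, P x -> exists n, locmod M J (x ^+ n)%:F.
Hypothesis JP : forall x, J x%:F -> P x.
Hypotheses (nPu : ~ loc P u) (uN : forall N, t_maximal N -> ~ subsetR P N -> loc N u).
Hypothesis Pval : valuation_subring (loc P).

Let Mp := t_maximal_prime tM.
Let Pid : ideal P := Pp.1.
Let Gs : submod G := @submod_colonR A.
Let As := submod_ext idI.
Let Js := submod_prodmod G As.

(* For [z] in [(P R_P : I)] some [u^-n] lies in [J R_M], so [z / u^n] is a sum of
   terms [(z a) g] with [z a] in [R_M], that is, [z / u^n] is in [(R : I) R_M].
   Multiplying back by [u^n] is harmless at the [N] not containing [P], while at
   the other ones [z I] is already contained in [P R_P = P R_N]. *)
Lemma colon_locmod z : (forall i, A i -> locmod P (ext P) (z * i)) ->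
  locmod M G z.
Proof.
move=> zI; have u0 : u != 0.
  by apply/eqP => u0; apply: nPu; rewrite u0; exact/loc_inR/inR0.
have [s nMs [a Pa Ea]] := locmod_ext_prime Pp Mp PM (hP tM) (locN_inv Pp Pval nPu).
have [n Jan] := radP Pa.
have zJ x : J x -> locmod M G (z * x).
  move=> [l [lAG ->]]; rewrite mulr_sumr; apply: submod_sum => [|p /lAG[Ap Gp]].
    exact: submod_locmod.
  rewrite mulrA; apply: locmodM => //; last exact: locmod_sub.
  exact: locmod_ext_loc (locmod_ext_prime Pp Mp PM (hP tM) (zI _ Ap)).
have [t nMt Jt] := Jan; have [d nMd Gd] := zJ _ Jt.
(* Since [u^-1 = a / s], the factor [s ^+ n] turns [u^-n] into [a ^+ n], then [t] brings this into
   [J], and [d] brings its product with [z] into [(R : I)]. *)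
pose w := d * (t * s ^+ n).
have nMw : ~ M w by do 2![apply: primeNM => //] => /(primeX Mp).
exists w => // i Ai; have zIP := zI _ Ai.
have Gw : G (w%:F * z / u ^+ n).
  suff -> : w%:F * z / u ^+ n = d%:F * (z * (t%:F * (a ^+ n)%:F)) by [].
  rewrite /w !tofracM !tofracXn -Ea exprMn exprVn.
  by rewrite mulrAC -!mulrA; congr (_ * _); rewrite [z * _]mulrC -!mulrA.
have [e e0 [f Ef]] := frac_denom (z * i).
have [_ _ RM] := submod_inR.
apply: t_local_global.
- exact: submod_inR.
- by move=> y; exact: tclos_inR.
- by exists e => //; rewrite -mulrA mulrCA Ef; apply/RM/inR_frac.
- move=> N tN; apply/locE; first exact: t_maximal_prime.
  have Np := t_maximal_prime tN; have [PN|/(uN tN) Nu] := pselect (subsetR P N).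
    rewrite -mulrA; apply: (locM Np); first exact/loc_inR/inR_frac.
    exact: locmod_ext_loc (locmod_ext_prime Pp Np PN (hP tN) zIP).
  have -> : w%:F * z * i = (w%:F * z / u ^+ n * i) * u ^+ n.
    by rewrite [RHS]mulrAC divfK // expf_neq0.
  by apply: (locM Np); [apply: (loc_inR Np); exact: Gw|exact: locX].
Qed.

(* If [p] were not in [J R_M], then [p / a] would not be in [(P R_P : I)] for any
   [a] in [I], which says that [I R_P = p I R_P]; since [p ^+ n] is in [J R_M],
   dividing by it would give [1] in [J R_P]. *)
Lemma radical_trace p : P p -> locmod M J p%:F.
Proof.
move=> Pp0; apply: contrapT => nJp.
have [Q0 _ _] := submod_locmod Mp Js.
have p0 : p%:F != 0 by apply/eqP => p0; apply: nJp; rewrite p0.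
have AI_div a : A a -> exists b c, [/\ A b, loc P c & a = p%:F * b * c].
  move=> Aa; have [->|a0] := eqVneq a 0.
    exists 0, 0; rewrite !mulr0; split=> //; last exact/loc_inR/inR0.
    by have [] := As.
  have [/colon_locmod[s nMs Gs']|] :=
      pselect (forall i, A i -> locmod P (ext P) (p%:F / a * i)).
    case: nJp; exists s => //.
    have -> : s%:F * p%:F = a * (s%:F * (p%:F / a)).
      by rewrite mulrCA [a * _]mulrC divfK.
    exact: prodmodM.
  move=> /existsNP[b /not_implyP[Ab nPb]].
  exists b, (p%:F / a * b)^-1; split; [by []|exact: locmodN_inv|].
  have b0 : b != 0.
    apply/eqP => b0; apply: nPb; rewrite b0 mulr0.
    by have [] := submod_locmod Pp (submod_ext Pid).
  by rewrite [_ / a * b]mulrAC invf_div mulrC divfK // mulf_neq0.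
have AI_divX k a : A a -> exists b c, [/\ A b, loc P c & a = p%:F ^+ k * b * c].
  elim: k a => [|k IHk] a Aa.
    by exists a, 1; rewrite expr0 mul1r mulr1; split=> //; exact/loc_inR/inR1.
  have [b [c [Ab Pc ->]]] := IHk _ Aa; have [b' [c' [Ab' Pc' ->]]] := AI_div _ Ab.
  exists b', (c' * c); split=> //; first exact: locM.
  by rewrite exprSr !mulrA.
have [n [s nMs Jsp]] := radP Pp0.
(* The element in question is just [s], so [s' * s] lies in [J] and thus in [P], although neither
   factor does. *)
have [s' nPs'] : locmod P J (p%:F ^- n * (s%:F * (p ^+ n)%:F)).
  apply: (@prodmod_sub A G (fun x => locmod P J (p%:F ^- n * x))) Jsp.
    have [L0 LD LM] := submod_locmod Pp Js.
    split=> [|x y|r x]; first by rewrite mulr0.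
      by rewrite mulrDr; exact: LD.
    by rewrite mulrCA; exact: LM.
  move=> a g Aa Gg; have [b [c [Ab Pc ->]]] := AI_divX n _ Aa.
  have -> : p%:F ^- n * (p%:F ^+ n * b * c * g) = c * (b * g).
    by rewrite -!mulrA mulKf ?expf_neq0 // mulrCA.
  by apply: locmodM => //; apply: locmod_sub => //; exact: prodmodM.
rewrite tofracXn [_ ^- _ * _]mulrCA mulVf ?expf_neq0 // mulr1 -tofracM => /JP.
by have [_ [_ PpM]] := Pp; move=> /PpM[//|/PM].
Qed.

End Trace.

(** * From t## to tRTP *)

Lemma t_sharp_sharp_tRTP : t_sharp_sharp R -> tRTP R.
Proof.
move=> ts I [idI nzI] /=; set A := ext I; set J := prodmod A (colonR A).
(* The whole ring also satisfies the radical condition, so this alternative can be proved in every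
   case. *)
right=> r n Jrn; apply: contrapT => nJr.
have As : submod A := submod_ext idI.
have Js : submod J by exact/submod_prodmod.
have AJ a : I a -> J a%:F.
  move=> Ia; rewrite -[a%:F]mulr1; apply: prodmodM; first exact/ext_tofrac.
  by move=> _ [b _ ->]; rewrite mul1r; exact: inR_frac.
have nzJ : exists2 a, J a & a != 0.
  by have [a Ia a0] := nzI; exists a%:F; [exact: AJ|rewrite tofrac_eq0].
(* As [J_t] is t-closed, the absence of [r] is visible at some t-maximal [M], and it passes to the
   smaller module [J]. *)
have [M tM nMr] : exists2 M, t_maximal M & ~ locmod M J r%:F.
  apply: contrapT => nM; apply: nJr; apply: t_local_global.
  - exact: submod_tclos.
  - by move=> y; exact: tclos_idem.
  - have [a Ia a0] := nzI; exists a => //; rewrite mulrC.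
    have [_ _ JM] := Js.
    by apply: sub_tclos => //; exact/JM/AJ.
  - move=> N tN; apply: contrapT => nN; apply: nM; exists N => // -[s nNs Js'].
    by apply: nN; exists s => //; exact: sub_tclos.
have Mp := t_maximal_prime tM; have Mval := hP tM.
have [_ _ QM] := submod_locmod Mp Js.
have nQ1 : ~ locmod M J 1 by move=> /(QM r); rewrite mulr1.
pose P x := exists n, locmod M J (x ^+ n)%:F.
have Pp : prime_ideal P := locmod_radical_prime Mp Mval Js nQ1.
have PM : subsetR P M.
  move=> x [m [s nMs]]; rewrite -tofracM => Jx; apply: contrapT => nMx.
  apply: nQ1; exists (s * x ^+ m); last by rewrite mulr1.
  by apply: primeNM => // /(primeX Mp).
have JP x : J x%:F -> P x by move=> Jx; exists 1; exact: locmod_sub.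
have tP : t_prime P.
  apply: sub_t_maximal_t_prime tM PM => //.
  by have [a Ia a0] := nzI; exists a => //; exact/JP/AJ.
have [u nPu uN] := t_sharp_sharp_witness ts tP.
apply/nMr/(radical_trace idI tM Pp PM _ JP nPu uN (t_prime_val tP)) => //.
by exists n; exact: tclos_locmod.
Qed.

(** * From tRTP and branched t-primes to t## *)

Lemma tRTP_separate (P : R -> Prop) (F : (R -> Prop) -> Prop) :
  tRTP R -> t_prime P -> branched P ->
  (forall Q, F Q -> prime_ideal Q /\ ~ subsetR P Q) ->
  exists2 u, bigloc F u & ~ loc P u.
Proof.
move=> hT tP [Q0 [[Qid [Qpr [Qprim Qrad]]] QneP]] FnP.
have [Pp tiP] := tP; have Qs := submod_ext Qid.
have [[u Cu nPu]|nu] := pselect (exists2 u, colonR (ext Q0) u & ~ loc P u).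
  (* For [p] in [P] outside [Q], a power of [p] lies in [Q0]; it multiplies [u] into [R] and serves
     as a denominator outside [Q]. *)
  exists u => // Q /FnP[Qp /existsNP[p /not_implyP[Pp0 nQp]]].
  have [n Qpn] := (Qrad p).1 Pp0.
  apply/(locE Qp); exists (p ^+ n); first by move=> /(primeX Qp).
  by rewrite mulrC; apply/Cu/ext_tofrac.
case: QneP; have QP x : Q0 x -> P x by move=> Qx; apply/Qrad; exists 1%N; rewrite expr1.
set J := tclos (prodmod (ext Q0) (colonR (ext Q0))).
have nzQ : nonzero_ideal Q0.
  split=> //; have [[_ [p Pp0 p0]] _] := tiP; have [n Qpn] := (Qrad p).1 Pp0.
  by exists (p ^+ n) => //; rewrite expf_neq0.
have QJ x : Q0 x -> prodmod (ext Q0) (colonR (ext Q0)) x%:F.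
  move=> Qx; rewrite -[x%:F]mulr1; apply: prodmodM; first exact/ext_tofrac.
  by move=> _ [b _ ->]; rewrite mul1r; exact: inR_frac.
(* Now [(R : Q0)] lies in [R_P], so [J] localizes into [Q0 R_P]; as [Q0] is [P]-primary, [Q0 R_P]
   meets [R] in [Q0]. Then tRTP makes [Q0] radical, hence equal to [P]. *)
have JQ x : J x%:F -> Q0 x.
  move=> /(tclos_locmod Pp (t_prime_val tP) (submod_prodmod _ Qs))[s nPs] Js.
  have [t nPt] : locmod P (ext Q0) (s%:F * x%:F).
    apply: prodmod_sub Js; first exact: submod_locmod.
    move=> a g Qa Cg; rewrite mulrC; apply: locmodM => //; last exact: locmod_sub.
    by apply: contrapT => nPg; apply: nu; exists g.
  rewrite mulrA -!tofracM => /ext_tofrac; rewrite mulrC => Qx.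
  apply: contrapT => nQx; have [n Qst] := Qprim _ _ Qx nQx.
  have /(primeX Pp) : P ((t * s) ^+ n) by exact: QP.
  exact: primeNM.
have [JR|Jrad] := hT Q0 nzQ.
  by case: Qpr; apply/JQ/JR; rewrite tofrac1; exact: inR1.
move=> x; split=> [|/Qrad[n Qxn]]; first exact: QP.
apply/JQ/(Jrad x n)/sub_tclos; last exact: QJ.
by have [_ [q Qq q0]] := nzQ; exists q%:F; [exact: QJ|rewrite tofrac_eq0].
Qed.

Lemma tRTP_t_sharp_sharp : tRTP R ->
  (forall P : R -> Prop, t_prime P -> branched P) -> t_sharp_sharp R.
Proof.
move=> hT hB F1 F2.
(* A member [P] of [E1] inside no member of [E2] would give an element of every [R_Q] with [Q] in
   [E2] but outside [R_P]. *)
have covered (E1 E2 : (R -> Prop) -> Prop) : incomparable_t_family E1 -> incomparable_t_family E2 ->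
    (forall x, bigloc E2 x -> bigloc E1 x) ->
    forall P, E1 P -> exists2 Q, E2 Q & subsetR P Q.
  move=> [E1t _] [E2t _] E21 P E1P; apply: contrapT => nPQ; have tP := E1t P E1P.
  have [Q E2Q|u E2u nPu] := @tRTP_separate P E2 hT tP (hB P tP).
    by split; [case: (E2t Q E2Q)|move=> PQ; apply: nPQ; exists Q].
  exact/nPu/E21.
move=> F1t F2t F12 EF; apply: F12.
have c12 := covered F1 F2 F1t F2t (fun x => (EF x).2).
have c21 := covered F2 F1 F2t F1t (fun x => (EF x).1).
(* Covering both ways gives [P] inside [Q] inside [P'] with [P] and [P'] in [E1]; incomparability
   collapses the chain. *)
have sub (E1 E2 : (R -> Prop) -> Prop) : incomparable_t_family E1 ->
    (forall P, E1 P -> exists2 Q, E2 Q & subsetR P Q) ->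
    (forall P, E2 P -> exists2 Q, E1 Q & subsetR P Q) -> forall P, E1 P -> E2 P.
  move=> [_ E1i] d12 d21 P E1P; have [Q E2Q PQ] := d12 P E1P.
  have [P' E1P' QP'] := d21 Q E2Q.
  suff -> : P = Q by [].
  apply/funext => x; apply/propext; split=> [/PQ//|/QP'].
  by apply: (E1i P P') => // y /PQ /QP'.
by apply/funext => P; apply/propext; split; apply: sub.
Qed.

End PvMD.
End TIdeals.

Theorem theorem1p10 (R : idomainType)
  (hnotfield : exists r : R, r != 0%R /\ r \isn't a GRing.unit)
  (hP : PvMD R) :
  (t_sharp_sharp R -> tRTP R) /\
  (tRTP R -> (forall P : R -> Prop, t_prime P -> branched P) -> t_sharp_sharp R).
Proof. by split; [exact: t_sharp_sharp_tRTP|exact: tRTP_t_sharp_sharp]. Qed.
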